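(* Let $\mathbb{K}$ be a symmetric cone of rank at least $5$, let $(\mathbb{E},\circ,\bullet)$ be an associated Euclidean Jordan algebra satisfying $\mathbb{E}_+=\mathbb{K}$, and let $n=\dim\mathbb{E}$. Let $\Delta=\{\delta_1,\dots,\delta_5\}$ be a set whose elements are pairwise orthogonal (i.e. $\delta_i\bullet\delta_j=0$ for $i\neq j$) and each generate an extreme ray of $\mathbb{K}$, and let $$H_\Delta=\sum_{i=1}^5\delta_i\otimes\delta_i-\sum_{i=1}^5(\delta_i\otimes\delta_{i\dotplus 1}+\delta_{i\dotplus 1}\otimes\delta_i)+\sum_{i=1}^5(\delta_i\otimes\delta_{i\dotplus 2}+\delta_{i\dotplus 2}\otimes\delta_i),$$ where $\dotplus$ denotes addition modulo $5$ on $\{1,\dots,5\}$. Then the quartic form $x\mapsto q_{H_\Delta}(x^2)=x^2\bullet H_\Delta(x^2)$ on $\mathbb{E}$ does not belong to $\Sigma^{n,4}(\mathbb{E})$; that is, $H_\Delta\notin\mathcal{I}_0(\mathbb{E}_+)$.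
   Context: A subset $K$ of a real vector space is a cone if $ax\in K$ for all $a\ge 0$, $x\in K$. A closed cone $\mathbb{K}$ in a finite-dimensional real inner product space $(\mathbb{E},\bullet)$ is a symmetric cone if it is self-dual ($\mathbb{K}=\{x\in\mathbb{E}\mid x\bullet y\ge 0\ \forall y\in\mathbb{K}\}$) and homogeneous (for any interior points $x,y$ of $\mathbb{K}$ there is an invertible linear $G:\mathbb{E}\to\mathbb{E}$ with $G(\mathbb{K})=\mathbb{K}$ and $G(x)=y$). Euclidean Jordan algebras and rank. A Jordan algebra is a finite-dimensional real vector space with a commutative bilinear product $\circ$ satisfying $x\circ(x^2\circ y)=x^2\circ(x\circ y)$, where $x^2:=x\circ x$; it is assumed to have a unit element. It is Euclidean if it has an inner product $\bullet$ that is associative: $(x\circ y)\bullet z=x\bullet(y\circ z)$. For a Euclidean Jordan algebra, $\mathbb{E}_+:=\{x^2\mid x\in\mathbb{E}\}$ is a symmetric cone, and every symmetric cone $\mathbb{K}$ in $(\mathbb{E},\bullet)$ arises this way from a product $\circ$ on $\mathbb{E}$ that is unique up to Jordan algebra isomorphism. An idempotent is $c$ with $c^2=c$; it is primitive if it is nonzero and not a sum of two nonzero idempotents; idempotents $c_1,\dots,c_k$ are orthogonal if $c_i\circ c_j=0$ for $i\ne j$. A Jordan frame is a set $\{c_1,\dots,c_r\}$ of orthogonal primitive idempotents whose sum is the unit element; the number $r$ does not depend on the frame and is the rank of $\mathbb{E}$ and of $\mathbb{K}=\mathbb{E}_+$. A nonzero $x\in\mathbb{K}$ generates an extreme ray $\mathbb{R}_+x=\{ax\mid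 a\ge0\}$ of $\mathbb{K}$ if, whenever $a,b\in\mathbb{K}$ satisfy $a+b\in\mathbb{R}_+x$, one has $a,b\in\mathbb{R}_+x$. For $a,b\in\mathbb{E}$, $a\otimes b$ denotes the linear transformation $x\mapsto(b\bullet x)a$. $\mathcal{S}(\mathbb{E})$ is the space of self-adjoint linear transformations on $\mathbb{E}$, and for $A\in\mathcal{S}(\mathbb{E})$, $q_A(x):=x\bullet A(x)$. Addition modulo $5$ takes values in $\{1,\dots,5\}$, e.g. $4\dotplus 2=1$. $\Sigma^{n,2m}(\mathbb{E})$ is the cone of (finite) sums of squares of forms (homogeneous polynomials) of degree $m$ with real coefficients on the $n$-dimensional space $\mathbb{E}$. For each nonnegative integer $l$, $\mathcal{I}_l(\mathbb{E}_+):=\{A\in\mathcal{S}(\mathbb{E})\mid (x\bullet x)^l q_A(x^2)\in\Sigma^{n,2(l+2)}(\mathbb{E})\}$. *)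

(* Defs.v *)
From HB Require Import structures.
From mathcomp Require Import all_boot all_order all_algebra.
From mathcomp Require Import mpoly.
From mathcomp Require Import boolp classical_sets reals.

Set Implicit Arguments.
Unset Strict Implicit.
Unset Printing Implicit Defensive.

Import Order.TTheory GRing.Theory Num.Theory.

Local Open Scope classical_set_scope.
Local Open Scope ring_scope.

Section SymmetricCones.
Variables (R : realType) (E : vectType R) (dot : {dot E for @idfun R}).
Implicit Types (K : set E) (x y : E).

Definition is_cone K := forall (a : R) x, 0 <= a -> K x -> K (a *: x).

(* A [vectType] carries no topology; closedness and interior refer to the
   topology of the norm induced by [dot], written with squared distances. *)
Definition dot_closed K :=
  forall x,
    (forall eps : R, 0 < eps -> exists2 y, K y & dot (x - y) (x - y) < eps) ->
  K x.

Definition dot_interior K : set E :=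
  [set x | exists2 eps : R, 0 < eps &
             forall y, dot (x - y) (x - y) < eps -> K y].

Definition self_dual K := K = [set x | forall y, K y -> 0 <= dot x y].

Definition homogeneous_cone K :=
  forall x y, dot_interior K x -> dot_interior K y ->
    exists G : 'End(E), [/\ bijective G, G @` K = K & G x = y].

Record symmetric_cone K : Prop := SymmetricCone {
  symmetric_cone_cone : is_cone K;
  symmetric_cone_closed : dot_closed K;
  symmetric_cone_self_dual : self_dual K;
  symmetric_cone_homogeneous : homogeneous_cone K
}.

Definition ray x : set E := [set a *: x | a in [set a : R | 0 <= a]].

Definition generates_extreme_ray K x :=
  [/\ K x, x <> 0 &
      forall a b, K a -> K b -> ray x (a + b) -> ray x a /\ ray x b].

End SymmetricCones.

Section EuclideanJordanAlgebras.
Variables (R : realType) (E : vectType R) (dot : {dot E for @idfun R}).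
Variables (jmul : {bilinear E -> E -> E}) (e : E).
Implicit Types (x y z c : E).

Definition jsq x := jmul x x.

Record euclidean_jordan_algebra : Prop := EuclideanJordanAlgebra {
  jmulC : forall x y, jmul x y = jmul y x;
  jordan_identity : forall x y,
    jmul x (jmul (jsq x) y) = jmul (jsq x) (jmul x y);
  jmul1 : forall x, jmul e x = x;
  jmul_dotA : forall x y z, dot (jmul x y) z = dot x (jmul y z)
}.

Definition cone_of_squares : set E := range jsq.

Definition jidempotent c := jsq c = c.

Definition primitive_idempotent c :=
  [/\ jidempotent c, c <> 0 &
      ~ exists a b, [/\ jidempotent a, jidempotent b, a <> 0, b <> 0
                      & c = a + b]].

(* Indexing by ['I_r] loses nothing with respect to sets of [r] elements:
   orthogonal nonzero idempotents are distinct. *)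
Definition jordan_frame r (c : 'I_r -> E) :=
  [/\ forall i, primitive_idempotent (c i),
      forall i j, i != j -> jmul (c i) (c j) = 0
    & \sum_i c i = e].

(* All Jordan frames of a Euclidean Jordan algebra have the same size, so that
   one frame determines the rank. *)
Definition jordan_rank r := exists c : 'I_r -> E, jordan_frame c.

End EuclideanJordanAlgebras.

Section Forms.
Variables (R : realType) (E : vectType R).

(* Forms are homogeneous polynomials in the coordinates with respect to a fixed
   basis of [E]; the notion does not depend on the basis. *)
Definition is_form (m : nat) (f : E -> R) :=
  exists2 p : {mpoly R[\dim {:E}]}, p \is m.-homog &
    forall x, f x = p.@[fun i => coord (vbasis {:E}) i x].

(* The cone $\Sigma^{n,2m}(E)$ with n = dim E; the index [m] is the degree of
   the forms being squared, half the degree of their sum. *)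
Definition sos_forms (m : nat) : set (E -> R) :=
  [set F | exists k (f : 'I_k -> E -> R),
     (forall i, is_form m (f i)) /\ forall x, F x = \sum_i f i x ^+ 2].

End Forms.

Section QuadraticForms.
Variables (R : realType) (E : vectType R) (dot : {dot E for @idfun R}).
Variables (jmul : {bilinear E -> E -> E}).

Definition self_adjoint (A : 'End(E)) := forall x y, dot (A x) y = dot x (A y).

Definition qform (A : 'End(E)) (x : E) : R := dot x (A x).

Definition tensor (a b : E) : 'End(E) := linfun (fun x => dot b x *: a).

Lemma tensorE a b x : tensor a b x = dot b x *: a.
Proof.
have lin : linear (fun x => dot b x *: a).
  by move=> k u v; rewrite linearPr /= scalerDl scalerA.
pose f := HB.pack_for {linear E -> E} (fun x => dot b x *: a)
  (GRing.isLinear.Build _ _ _ _ _ lin).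
exact: (lfunE f).
Qed.

Definition inner_approx (l : nat) : set 'End(E) :=
  [set A | self_adjoint A /\
     sos_forms l.+2 (fun x => dot x x ^+ l * qform A (jsq jmul x))].

(* Indices are shifted from {1, ..., 5} to {0, ..., 4}; [i + 1] and [i + 2] are
   computed in the ring structure of ['I_5], that is, modulo 5. *)
Definition horn_map (delta : 'I_5 -> E) : 'End(E) :=
  \sum_(i < 5) tensor (delta i) (delta i)
  - \sum_(i < 5) (tensor (delta i) (delta (i + 1))
                  + tensor (delta (i + 1)) (delta i))
  + \sum_(i < 5) (tensor (delta i) (delta (i + 2))
                  + tensor (delta (i + 2)) (delta i)).

End QuadraticForms.

(* Main.v *)
Require Import Defs.
From mathcomp Require Import all_boot all_order all_algebra.
From mathcomp Require Import mpoly ring lra.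
From mathcomp Require Import boolp classical_sets reals.

Set Implicit Arguments.
Unset Strict Implicit.
Unset Printing Implicit Defensive.

Import Order.TTheory GRing.Theory Num.Theory.

Local Open Scope classical_set_scope.
Local Open Scope ring_scope.

(** The Horn quartic [h y = sum_i y_i^4 - 2 y_i^2 y_(i+1)^2 + 2 y_i^2 y_(i+2)^2]
    is not a sum of squares, for the following reason.  On the plane of the
    coordinates [y_i] and [y_(i+1)] it equals [(y_i^2 - y_(i+1)^2)^2], so it
    vanishes at [e_i + e_(i+1)] and [e_i - e_(i+1)], and so does every quadratic
    form [f] of a decomposition of [h] into squares.  By the parallelogram law
    [f e_(i+1) = - f e_i]; around a cycle of odd length 5 this forces
    [f e_0 = 0] for all those [f], whereas [h e_0 = 1] (lemma
    [odd_cycle_not_sos]).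

    The theorem follows by finding a copy of [h] inside the quartic form
    [x |-> q_H (x^2)].  Each [delta_i] is in the cone, so it is a square [z_i^2].
    If the [z_i] have pairwise zero products, then the square of
    [sum_i y_i z_i] is [sum_i y_i^2 delta_i], on which orthogonality of the
    [delta_i] makes [q_H] the Horn form, up to a rescaling of the [z_i].

    That orthogonal squares have roots with product zero
    ([sq_orthogonal_roots]) rests on self-duality of the cone: squares have
    nonnegative inner products.  This makes multiplication by a square positive semidefinite, so
    [x^2 . y^2 = (x^2 o y) . y = 0] forces [x^2 o y = 0]
    ([sq_orthogonal]).  To pass from [x^2 o y = 0] to [x o y = 0]
    ([sq_annihilator]), write [L] for the multiplication by [x]; the linearized
    Jordan identity gives [x^4 o y = - 4 L^4 y], and pairing with [y] makes the
    left side nonnegative and the right side [- 4 |L^2 y|^2], so that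
    [L^2 y = 0] and hence [L y = 0]. *)

Section InnerProduct.
Variables (R : realType) (E : vectType R) (dot : {dot E for @idfun R}).
Implicit Types (x y z : E).

Lemma dotC x y : dot x y = dot y x.
Proof. by rewrite hermC expr0 mul1r. Qed.

Lemma dot_gt0 x : x != 0 -> 0 < dot x x.
Proof. exact: neq0_dnorm_gt0. Qed.

Lemma dot_eq0 x : dot x x = 0 -> x = 0.
Proof.
move=> xx0; apply/eqP; apply: contra_eqT xx0 => /dot_gt0.
by rewrite lt0r => /andP[].
Qed.

Lemma dot_ge0 x : 0 <= dot x x.
Proof.
by have [->|/dot_gt0/ltW//] := eqVneq x 0; rewrite linear0r.
Qed.

Lemma dot_inj x y : (forall w, dot x w = dot y w) -> x = y.
Proof.
move=> xy; apply/subr0_eq; apply: (@dot_eq0 (x - y)).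
by rewrite linearBl /= xy subrr.
Qed.

(** Otherwise [f (v - t *: f v)] would pair negatively with [v - t *: f v] for
    small [t > 0]. *)
Lemma psd_isotropic (f : {linear E -> E}) v :
    (forall x y, dot (f x) y = dot x (f y)) -> (forall x, 0 <= dot (f x) x) ->
  dot (f v) v = 0 -> f v = 0.
Proof.
move=> f_sym f_ge0 fv_v; apply: dot_eq0.
set u := f v; set s := dot u u; set c := dot (f u) u.
have quad t : 0 <= t ^+ 2 * c - 2 * t * s.
  have := f_ge0 (v - t *: u).
  have -> : f (v - t *: u) = u - t *: f u by rewrite linearB linearZ.
  rewrite linearBl /= !linearBr /= !linearZl_LR /= !linearZr_LR /=.
  by rewrite fv_v f_sym -/u -/s -/c; lra.
have [s_ge0 c_ge0] : 0 <= s /\ 0 <= c by split; [exact: dot_ge0 | exact: f_ge0].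
apply/eqP; apply: contraT; rewrite -/s => s_neq0.
have s_gt0 : 0 < s by rewrite lt0r s_neq0.
(* Any [t] with [0 < t < 2 s / c] would do; adding 1 allows for [c = 0]. *)
have := quad (s / (c + 1)).
have -> : (s / (c + 1)) ^+ 2 * c - 2 * (s / (c + 1)) * s
    = - (s ^+ 2 * (c + 2) / (c + 1) ^+ 2) by field; lra.
rewrite oppr_ge0 leNgt divr_gt0 // ?mulr_gt0 ?exprn_gt0 //; lra.
Qed.

End InnerProduct.

Section EuclideanJordan.
Variables (R : realType) (E : vectType R) (dot : {dot E for @idfun R}).
Variables (jmul : {bilinear E -> E -> E}) (e : E).
Hypothesis E_eja : euclidean_jordan_algebra dot jmul e.
Implicit Types (u v w x y z : E).

Local Notation "x 'o' y" := (jmul x y) (at level 40, left associativity).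
Local Notation sq := (jsq jmul).

Let oC := jmulC E_eja.

(** The part of the Jordan identity at [x + y] that is quadratic in [x] and
    linear in [y]: by oddness in its first variable, half of the difference of
    the identities at [x + y] and [x - y], minus the identity at [y]. *)
Lemma jordan_linearized x y v :
  sq x o (y o v) - y o (sq x o v) + ((x o y) o (x o v)) *+ 2
    = (x o ((x o y) o v)) *+ 2.
Proof.
have Hp := jordan_identity E_eja (x + y) v.
have Hm := jordan_identity E_eja (x - y) v.
have Hy := jordan_identity E_eja y v.
move: Hp Hm Hy; rewrite /jsq.
rewrite !(linearDl, linearDr, linearNl, linearNr) /= (oC y x).
move=> Hp Hm Hy.
(* Pairing with [w] turns a linear combination of vector identities into one
   of real numbers. *)
apply: (@dot_inj _ _ dot) => w.
move: (congr1 (dot ^~ w) Hp) (congr1 (dot ^~ w) Hm) (congr1 (dot ^~ w) Hy).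
rewrite !(linearDl, linearBl, linearNl, linearMnl) /=.
lra.
Qed.

Lemma dot_jmulC u v w : dot (u o v) w = dot v (u o w).
Proof. by rewrite oC (jmul_dotA E_eja). Qed.

Hypothesis sq_dot_ge0 : forall x y, 0 <= dot (sq x) (sq y).

(** The inner product is the value at [y] of the quadratic form of the
    multiplication by [sq x], which is positive semidefinite. *)
Lemma sq_orthogonal x y : dot (sq x) (sq y) = 0 -> sq x o y = 0.
Proof.
move=> xy0; apply: (@psd_isotropic _ _ dot (jmul (sq x))) => [u v|u|] /=.
- exact: dot_jmulC.
- by rewrite (jmul_dotA E_eja); exact: sq_dot_ge0.
- by rewrite (jmul_dotA E_eja).
Qed.

(** Fourth powers make the sign argument work: [sq (sq z) o v] equals
    [- 4 L^4 v], where [L] is the multiplication by [z]. *)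
Lemma sq_annihilator z v : sq z o v = 0 -> z o v = 0.
Proof.
move=> av0; set u := z o v.
have au0 : sq z o u = 0 by rewrite -(jordan_identity E_eja) av0 linear0r.
have azu0 : sq z o (z o u) = 0 by rewrite -(jordan_identity E_eja) au0 linear0r.
have cube_u : u o (z o sq z) = - ((z o (z o (z o u))) *+ 2).
  have := jordan_linearized z u z.
  rewrite (oC u z) azu0 (oC _ (jmul z z)) azu0 mul0rn addr0 sub0r.
  by rewrite (oC (sq z) z) (oC (z o u) z) => <-; rewrite opprK.
have fourth_v : v o sq (sq z) = (u o (z o sq z)) *+ 2.
  have := jordan_linearized z v (sq z).
  rewrite -/u (oC v) av0 (oC u (sq z)) au0 !linear0r mul0rn sub0r => /eqP.
  by rewrite addrC subr_eq0 => /eqP <-.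
have zu0 : z o u = 0.
  apply: (@dot_eq0 _ _ dot); apply/eqP; rewrite eq_le dot_ge0 andbT.
  have : 0 <= dot (v o sq (sq z)) v.
    by rewrite oC (jmul_dotA E_eja); exact: sq_dot_ge0.
  rewrite fourth_v cube_u linearMnl /= linearNl /= linearMnl /=.
  by rewrite (dot_jmulC z) -/u (dot_jmulC z); lra.
by apply: (@dot_eq0 _ _ dot); rewrite dot_jmulC zu0 linear0r.
Qed.

Lemma sq_orthogonal_roots x y : dot (sq x) (sq y) = 0 -> x o y = 0.
Proof. by move=> /sq_orthogonal/sq_annihilator. Qed.

End EuclideanJordan.

Section OddCycle.
Variables (R : realType) (E : vectType R).

(** On a monomial of degree 2, a product of two coordinates, this is the
    identity [(a + c)(b + d) + (a - c)(b - d) = 2 (a b + c d)]. *)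
Lemma form2_parallelogram (f : E -> R) x y :
  is_form 2 f -> f (x + y) + f (x - y) = (f x + f y) *+ 2.
Proof.
case=> p /dhomogP p_homog fE; rewrite !fE !mevalE -!big_split -sumrMnl /=.
rewrite !big_seq; apply: eq_bigr => m /p_homog /= mdeg_m.
have [i [j ->]] : exists i j, m = (U_(i) + U_(j))%MM.
  have [i mi] : exists i, m i != 0%N.
    apply/existsP; apply: contra_eqT mdeg_m => /existsPn m0.
    suff -> : m = 0%MM by rewrite mdeg0.
    by apply/mnmP => i; rewrite mnm0E; have := m0 i; rewrite negbK => /eqP.
  have m_i : (m - U_(i) + U_(i))%MM = m by rewrite submK // lep1mP.
  have : mdeg (m - U_(i)) == 1%N.
    by move: mdeg_m; rewrite -{1}m_i mdegD mdeg1 addn1 => -[->].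
  rewrite mdeg_eq1 => /existsP[j /eqP m_j].
  by exists j, i; rewrite -m_j m_i.
have monE (v : 'I_(\dim {:E}) -> R) :
    \prod_k v k ^+ (U_(i) + U_(j))%MM k = v i * v j.
  by rewrite -mevalX mpolyXD mevalM !mevalXU.
by rewrite !monE !linearD !linearN /=; ring.
Qed.

(** Each form being squared vanishes at the zeros of [F], hence changes sign from
    [b i] to [b (i + 1)]; after an odd number of steps it is back at [b 0] with
    the opposite value. *)
Lemma odd_cycle_not_sos n (b : 'I_n.+2 -> E) (F : E -> R) :
    odd n -> F (b 0) != 0 ->
    (forall i, F (b i + b (i + 1)) = 0) ->
    (forall i, F (b i - b (i + 1)) = 0) ->
  ~ sos_forms 2 F.
Proof.
move=> n_odd Fb0 Fp Fm [k [f [f_form FE]]].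
have f0 x : F x = 0 -> forall t, f t x = 0.
  rewrite FE => /eqP; rewrite psumr_eq0 => [/allP F0 t|t _]; last exact: sqr_ge0.
  by apply/eqP; rewrite -sqrf_eq0; apply: F0; rewrite mem_index_enum.
case/eqP: Fb0; rewrite FE big1 // => t _.
have alt i : f t (b (i + 1)) = - f t (b i).
  have := form2_parallelogram (b i) (b (i + 1)) (f_form t).
  by rewrite (f0 _ (Fp i)) (f0 _ (Fm i)); lra.
have pow m : f t (b m%:R) = (-1) ^+ m * f t (b 0).
  by elim: m => [|m IHm]; rewrite ?mul1r // -natr1 alt IHm exprS mulN1r mulNr.
have := pow n.+2; rewrite (_ : n.+2%:R = 0); last exact: (@pchar_Zp n.+2).
rewrite -signr_odd /= negbK n_odd expr1 mulN1r => f_b0.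
suff -> : f t (b 0) = 0 by rewrite expr0n.
lra.
Qed.

End OddCycle.

Section HornForm.
Variables (R : realType) (E : vectType R) (dot : {dot E for @idfun R}).
Variables (delta : 'I_5 -> E) (x : E).

Lemma qform_horn (d : 'I_5 -> R) : (forall i, dot (delta i) x = d i) ->
  qform dot (horn_map dot delta) x =
    \sum_i (d i ^+ 2 - 2 * d i * d (i + 1) + 2 * d i * d (i + 2)).
Proof.
move=> dE; have dE' i : dot x (delta i) = d i by rewrite dotC.
have tensor_form i j : dot x (tensor dot (delta i) (delta j) x) = d i * d j.
  by rewrite tensorE linearZr_LR /= dE dE' mulrC.
rewrite /qform /horn_map add_lfunE add_lfunE opp_lfunE !sum_lfunE.
rewrite linearDr /= linearBr /= !linear_sumr -sumrB -big_split /=.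
apply: eq_bigr => i _.
by rewrite !add_lfunE !linearDr /= !tensor_form; ring.
Qed.

End HornForm.

Theorem theorem5p2 (R : realType) (E : vectType R) (dot : {dot E for @idfun R})
    (jmul : {bilinear E -> E -> E}) (e : E) (K : set E) (r : nat)
    (delta : 'I_5 -> E)
    (K_sym : symmetric_cone dot K)
    (E_eja : euclidean_jordan_algebra dot jmul e)
    (K_squares : cone_of_squares jmul = K)
    (rank_r : jordan_rank jmul e r) (r_ge5 : (5 <= r)%N)
    (delta_orth : forall i j, i != j -> dot (delta i) (delta j) = 0)
    (delta_extreme : forall i, generates_extreme_ray K (delta i)) :
  ~ sos_forms 2 (fun x => qform dot (horn_map dot delta) (jsq jmul x)) /\
  ~ inner_approx dot jmul 0 (horn_map dot delta).
Proof.
have sq_in_K x : K (jsq jmul x) by rewrite -K_squares; exists x.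
have sq_dot_ge0 x y : 0 <= dot (jsq jmul x) (jsq jmul y).
  by have := sq_in_K x; rewrite {1}(symmetric_cone_self_dual K_sym); apply.
have /choice[z zE] i : exists z, jsq jmul z = delta i.
  by have [] := delta_extreme i; rewrite -K_squares => -[z _ <-]; exists z.
have delta_gt0 i : 0 < dot (delta i) (delta i).
  by apply: dot_gt0; have [_ /eqP] := delta_extreme i.
(* Rescale the roots so that the squares of the [b i] are dual to [delta]. *)
pose s i := (Num.sqrt (dot (delta i) (delta i)))^-1.
pose b i := s i *: z i.
have b_orth i j : i != j -> jmul (b i) (b j) = 0.
  move=> ij; rewrite linearZl_LR linearZr_LR /=.
  rewrite (sq_orthogonal_roots E_eja sq_dot_ge0) ?scaler0 //.
  by rewrite !zE delta_orth.
have dual_b k i : dot (delta k) (jmul (b i) (b i)) = (k == i)%:R.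
  have -> : jmul (b i) (b i) = s i ^+ 2 *: delta i.
    by rewrite linearZl_LR linearZr_LR /= scalerA -expr2 -zE.
  rewrite linearZr_LR /=.
  have [->|/delta_orth ->] := eqVneq k i; last by rewrite mulr0.
  rewrite exprVn sqr_sqrtr ?ltW // mulVf //.
  by rewrite gt_eqF.
pose F x := qform dot (horn_map dot delta) (jsq jmul x).
have succ_neq (i : 'I_5) : i != i + 1.
  by case: i => -[|[|[|[|[|]]]]].
(* The quadratic form of the Horn matrix vanishes at the sum of two
   consecutive basis vectors. *)
have edge0 (i : 'I_5) x :
    (forall k, dot (delta k) x = (k == i)%:R + (k == i + 1)%:R) ->
    qform dot (horn_map dot delta) x = 0.
  move=> /qform_horn ->; rewrite !big_ord_recl big_ord0.
  case: i => -[|[|[|[|[|]]]]] //= ?; ring.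
have notsos : ~ sos_forms 2 F.
  apply: (@odd_cycle_not_sos _ _ 3 b) => // [|i|i].
  - rewrite /F (@qform_horn _ _ _ _ _ (fun k => (k == 0)%:R)); last first.
      by move=> k; exact: dual_b.
    rewrite !big_ord_recl big_ord0 /=.
    by apply/eqP; lra.
  - apply: (edge0 i) => k; rewrite /jsq !(linearDl, linearDr) /=.
    rewrite [jmul (b (i + 1)) (b i)](jmulC E_eja) (b_orth _ _ (succ_neq i)).
    by rewrite !(linear0r, addr0, add0r) /= !dual_b.
  - apply: (edge0 i) => k; rewrite /jsq.
    rewrite !(linearDl, linearDr, linearNl, linearNr) /=.
    rewrite [jmul (b (i + 1)) (b i)](jmulC E_eja) (b_orth _ _ (succ_neq i)).
    by rewrite !(linear0r, opprK, oppr0, addr0, add0r) /= !dual_b.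
split=> // -[_ sosF]; apply: notsos; congr (sos_forms _ _): sosF.
by apply/funext => x; rewrite expr0 mul1r.
Qed.
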